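(* Let $(P,e)$ be a tree pattern with $P\in\mathcal{T}_k$, and let $\sigma(P,e)=(\tau(P),C)$ be the mesh pattern defined below. Then for every $n\ge 0$, the preorder map $\tau$ restricts to a bijection $\tau\colon \mathcal{T}_n(P,e)\to S_n(231,\sigma(P,e))$, where $S_n(231,\sigma(P,e))$ is the set of permutations of $[n]$ that avoid both the classical pattern $231$ and the mesh pattern $\sigma(P,e)$.
   Context: For $n\ge 0$, $\mathcal{T}_n$ is the set of binary trees with $n$ vertices (every vertex has at most one left and at most one right child), with vertices labeled $1,\dots,n$ by the search tree property (vertices in the left subtree of $i$ are smaller than $i$, those in its right subtree larger); $\mathcal{T}_0=\{\varepsilon\}$. For a vertex $i$: $c_L(i),c_R(i),p(i)$ denote its left child, right child, parent ($\varepsilon$ if nonexistent); $r(T)$ is the root; $T(i)$ is the subtree rooted at $i$; $L(i),R(i)$ are the subtrees rooted at $c_L(i),c_R(i)$ (empty if that child does not exist); $L(T)=L(r(T))$, $R(T)=R(r(T))$. $B_R(i)=\{i,c_R(i),c_R^2(i),\dots\}$ is the set of vertices of the right branch starting at $i$ (following right children as long as they exist), and $B_R^-(i)$ is $B_R(i)$ with its last (lowest) vertex removed. A tree pattern is a pair $(P,e)$ with $P\in\mathcal{T}_k$ and $e\colon[k]\setminus\{r(P)\}\to\{0,1\}$. A tree $T\in\mathcal{T}_n$ contains $(P,e)$ if there is an injection $f\colon[k]\to[n]$ such that for every non-root vertex $i$ of $P$: if $e(i)=1$, then $f(i)$ is the left (resp. right) child of $f(p(i))$ in $T$ when $i$ is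 the left (resp. right) child of $p(i)$ in $P$; if $e(i)=0$, then $f(i)\in L(f(p(i)))$ (resp. $f(i)\in R(f(p(i)))$) when $i$ is the left (resp. right) child of $p(i)$. Otherwise $T$ avoids $(P,e)$; $\mathcal{T}_n(P,e)$ is the set of $T\in\mathcal{T}_n$ avoiding $(P,e)$. The preorder permutation is defined by $\tau(\varepsilon)=$ empty and $\tau(T)=(r(T),\tau(L(T)),\tau(R(T)))$. Mesh patterns: for $\pi\in S_n$ let $G(\pi)=\{(i,\pi(i)):i\in[n]\}$. A mesh pattern is $(\tau,C)$ with $\tau\in S_k$, $C\subseteq\{0,\dots,k\}^2$. A permutation $\pi\in S_n$ contains $(\tau,C)$ if there are indices $\nu_1<\dots<\nu_k$ such that $\pi(\nu_1),\dots,\pi(\nu_k)$ are in the same relative order as $\tau$, and, letting $\lambda_1<\dots<\lambda_k$ be these values sorted, with $\nu_0=\lambda_0=0$, $\nu_{k+1}=\lambda_{k+1}=n+1$, we have $G(\pi)\cap\big((\nu_i,\nu_{i+1})\times(\lambda_j,\lambda_{j+1})\big)=\emptyset$ for all $(i,j)\in C$. Classical pattern containment is the case $C=\emptyset$. Definition of $\sigma(P,e)$: let $\rho=\tau(P)^{-1}$. For $i\in[k]$ let $C_i=\{(\rho(i)-1,j): j\in B_R^-(i)\}$; for $i\in[k]\setminus\{r(P)\}$ let $C_i'=\emptyset$ if $e(i)=0$ and $C_i'=\{(\rho(i)-1,\min P(i)-1),(\rho(i)-1,\max P(i))\}$ if $e(i)=1$, where $\min P(i),\max P(i)$ are the smallest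 and largest vertex labels in the subtree $P(i)$. Then $\sigma(P,e)=\big(\tau(P),\bigcup_{i\in[k]}C_i\cup\bigcup_{i\in[k]\setminus\{r(P)\}}C_i'\big)$. *)

(* Defs.v *)
From mathcomp Require Import all_boot.
Set Implicit Arguments. Unset Strict Implicit. Unset Printing Implicit Defensive.

(* Unlabeled binary trees; the labels 1..n are forced by the search-tree
   property (in-order labeling).  A subtree stored at offset [off] carries
   the labels off+1, ..., off + tsize t. *)
Inductive btree := BLeaf | BNode of btree & btree.

Fixpoint tsize (t : btree) : nat :=
  match t with BLeaf => 0 | BNode l r => tsize l + 1 + tsize r end.

Definition root_at (t : btree) (off : nat) : option nat :=
  match t with BLeaf => None | BNode l _ => Some (off + tsize l + 1) end.

Fixpoint lch (t : btree) (off i : nat) : option nat :=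
  match t with
  | BLeaf => None
  | BNode l r => let v := off + tsize l + 1 in
      if i == v then root_at l off else if i < v then lch l off i else lch r v i
  end.

Fixpoint rch (t : btree) (off i : nat) : option nat :=
  match t with
  | BLeaf => None
  | BNode l r => let v := off + tsize l + 1 in
      if i == v then root_at r v else if i < v then rch l off i else rch r v i
  end.

Fixpoint subl (t : btree) (off i : nat) : seq nat :=
  match t with
  | BLeaf => [::]
  | BNode l r => let v := off + tsize l + 1 in
      if i == v then iota off.+1 (tsize t)
      else if i < v then subl l off i else subl r v i
  end.

Fixpoint lsub (t : btree) (off i : nat) : seq nat :=
  match t with
  | BLeaf => [::]
  | BNode l r => let v := off + tsize l + 1 in
      if i == v then iota off.+1 (tsize l)
      else if i < v then lsub l off i else lsub r v i
  end.

Fixpoint rsub (t : btree) (off i : nat) : seq nat :=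
  match t with
  | BLeaf => [::]
  | BNode l r => let v := off + tsize l + 1 in
      if i == v then iota v.+1 (tsize r)
      else if i < v then rsub l off i else rsub r v i
  end.

Fixpoint rspine (t : btree) (off : nat) : seq nat :=
  match t with
  | BLeaf => [::]
  | BNode l r => let v := off + tsize l + 1 in v :: rspine r v
  end.

Fixpoint branchR (t : btree) (off i : nat) : seq nat :=
  match t with
  | BLeaf => [::]
  | BNode l r => let v := off + tsize l + 1 in
      if i == v then rspine t off
      else if i < v then branchR l off i else branchR r v i
  end.

Definition branchR_minus (t : btree) (i : nat) : seq nat :=
  let s := branchR t 0 i in take (size s).-1 s.

Fixpoint pre (t : btree) (off : nat) : seq nat :=
  match t with
  | BLeaf => [::]
  | BNode l r => let v := off + tsize l + 1 in v :: (pre l off ++ pre r v)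
  end.

Definition tau (t : btree) : seq nat := pre t 0.

Definition troot (t : btree) : option nat := root_at t 0.

(* Tree pattern containment: e : nat -> bool, only its values on the
   non-root vertices of P matter. *)
Definition tcontains (T P : btree) (e : nat -> bool) : Prop :=
  exists f : nat -> nat,
    {in iota 1 (tsize P), forall i, f i \in iota 1 (tsize T)} /\
    {in iota 1 (tsize P) &, injective f} /\
    (forall p i, p \in iota 1 (tsize P) -> i \in iota 1 (tsize P) ->
       (lch P 0 p = Some i ->
          if e i then lch T 0 (f p) = Some (f i) else f i \in lsub T 0 (f p)) /\
       (rch P 0 p = Some i ->
          if e i then rch T 0 (f p) = Some (f i) else f i \in rsub T 0 (f p))).

Definition tavoids (T P : btree) (e : nat -> bool) : Prop := ~ tcontains T P e.

(* Permutations of [n] are words (one-line notation) [pi(1); ...; pi(n)]. *)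
Definition is_perm (n : nat) (pi : seq nat) : bool := perm_eq pi (iota 1 n).

(* value pi(x), 1-based *)
Definition pval (pi : seq nat) (x : nat) : nat := nth 0 pi x.-1.

Definition mcontains (pi : seq nat) (tau : seq nat) (C : seq (nat * nat)) : Prop :=
  let n := size pi in
  exists nu : seq nat,
    [/\ size nu = size tau,
        sorted ltn nu,
        all (fun x => 0 < x <= n) nu,
        (forall a b, a < size tau -> b < size tau ->
           (pval pi (nth 0 nu a) < pval pi (nth 0 nu b)) = (nth 0 tau a < nth 0 tau b))
      & let nuext i := nth n.+1 (0 :: nu) i in
        let lamext j := nth n.+1 (0 :: sort leq [seq pval pi x | x <- nu]) j in
        forall ij, ij \in C -> forall x, 0 < x <= n ->
          ~~ ((nuext ij.1 < x < nuext ij.1.+1) &&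
              (lamext ij.2 < pval pi x < lamext ij.2.+1))].

Definition mavoids (pi tau : seq nat) (C : seq (nat * nat)) : Prop :=
  ~ mcontains pi tau C.

Definition avoids231 (pi : seq nat) : Prop := mavoids pi [:: 2; 3; 1] [::].

Definition minl (s : seq nat) : nat := foldr minn (head 0 s) s.
Definition maxl (s : seq nat) : nat := foldr maxn 0 s.

Definition sigmaC (P : btree) (e : nat -> bool) : seq (nat * nat) :=
  let rho i := (index i (tau P)).+1 in
  flatten [seq [seq ((rho i).-1, j) | j <- branchR_minus P i] ++
               (if (troot P != Some i) && e i then
                  [:: ((rho i).-1, (minl (subl P 0 i)).-1);
                      ((rho i).-1, maxl (subl P 0 i))]
                else [::])
          | i <- iota 1 (tsize P)].

Definition Tn_avoid (n : nat) (P : btree) (e : nat -> bool) (T : btree) : Prop :=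
  tsize T = n /\ tavoids T P e.

Definition Sn_avoid (n : nat) (P : btree) (e : nat -> bool) (pi : seq nat) : Prop :=
  [/\ is_perm n pi, avoids231 pi & mavoids pi (tau P) (sigmaC P e)].

(* Main.v *)
Require Import Defs.
From mathcomp Require Import all_boot.
From mathcomp Require Import zify.
(* [all_boot] also exports a [tsize] (from tuple.v), which must be shadowed. *)
Import Defs.
Set Implicit Arguments. Unset Strict Implicit. Unset Printing Implicit Defensive.

(** A binary tree is determined by two linear orders on its vertices: the labels
    and the preorder positions.  The subtree of [i] is an interval of labels
    ]lo, hi] such that [i] precedes all of its other vertices, every vertex after
    [i] has a label exceeding [lo], and both [lo] and [hi + 1], when they are
    labels, precede [i]; moreover the preorder word avoids 231.  In these terms
    one and the same map [f] is an occurrence of the tree pattern in [T] and of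
    the mesh pattern in [tau T].  Given a tree occurrence, every shaded cell is
    empty because [f] maps subtrees into subtrees.  Given a mesh occurrence, a
    vertex [q] preceding [f i] whose label separates [f i] from the image of a
    vertex of the right subtree of [i] would, by 231-avoidance, lie in the
    right-branch cell of the first pattern vertex whose image follows [q]; the two
    cells attached to an edge with [e i = 1] exclude in the same way the child of
    [f p] lying strictly above [f i]. *)

(** * Preorder words of trees *)

Lemma size_pre t off : size (pre t off) = tsize t.
Proof.
elim: t off => [|l IHl r IHr] off //=.
by rewrite size_cat IHl IHr; lia.
Qed.

Lemma mem_pre t off x : (x \in pre t off) = (off < x <= off + tsize t).
Proof.
elim: t off => [|l IHl r IHr] off /=; first by rewrite in_nil; lia.
by rewrite in_cons mem_cat IHl IHr; lia.
Qed.

Lemma index_pre_lt t off x : off < x <= off + tsize t ->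
  index x (pre t off) < tsize t.
Proof. by rewrite -mem_pre -index_mem size_pre. Qed.

Lemma pre_uniq t off : uniq (pre t off).
Proof.
elim: t off => [|l IHl r IHr] off //=.
rewrite mem_cat !mem_pre cat_uniq IHl IHr andbT /=; apply/andP; split; first lia.
by apply/hasPn => x; rewrite !mem_pre; lia.
Qed.

(** The first letter determines the size of the left subtree, hence where to cut the rest of the
    word. *)
Lemma pre_inj t1 t2 off : pre t1 off = pre t2 off -> t1 = t2.
Proof.
elim: t1 t2 off => [|l1 IHl r1 IHr] [|l2 r2] off //= [].
move=> hv hs.
have hl : tsize l1 = tsize l2 by lia.
move/eqP: hs; rewrite eqseq_cat ?size_pre // hl => /andP[/eqP h1 /eqP h2].
by rewrite (IHl _ _ h1) (IHr _ _ h2).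
Qed.

(** * Subtrees as intervals of labels *)

(** All label-indexed functions on trees follow the same search path to [i]. This one factors the
    search out and keeps the offset of the subtree found. *)
Fixpoint subtree_at (t : btree) (off i : nat) : btree * nat :=
  match t with
  | BLeaf => (BLeaf, off)
  | BNode l r => let v := off + tsize l + 1 in
      if i == v then (t, off)
      else if i < v then subtree_at l off i else subtree_at r v i
  end.

(* The vertex set of the subtree rooted at [i] is the interval ]lo t i, hi t i]. *)
Definition lo t i := (subtree_at t 0 i).2.
Definition hi t i := (subtree_at t 0 i).2 + tsize (subtree_at t 0 i).1.
(** Counted from 0, so that [pos P i] is the column of the cells that the mesh pattern attaches to
    [i]. *)
Definition pos t x := index x (tau t).

Lemma lch_subtree t off i : lch t off i =
  if subtree_at t off i is (BNode l r, o) then root_at l o else None.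
Proof. by elim: t off => [|l IHl r IHr] off //=; do 2![case: ifP => // _]. Qed.

Lemma rch_subtree t off i : rch t off i =
  if subtree_at t off i is (BNode l r, o) then root_at r (o + tsize l + 1)
  else None.
Proof. by elim: t off => [|l IHl r IHr] off //=; do 2![case: ifP => // _]. Qed.

Lemma lsub_subtree t off i : lsub t off i =
  if subtree_at t off i is (BNode l r, o) then iota o.+1 (tsize l) else [::].
Proof. by elim: t off => [|l IHl r IHr] off //=; do 2![case: ifP => // _]. Qed.

Lemma rsub_subtree t off i : rsub t off i =
  if subtree_at t off i is (BNode l r, o)
  then iota (o + tsize l + 1).+1 (tsize r) else [::].
Proof. by elim: t off => [|l IHl r IHr] off //=; do 2![case: ifP => // _]. Qed.

Lemma subl_subtree t off i :
  subl t off i = iota (subtree_at t off i).2.+1 (tsize (subtree_at t off i).1).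
Proof. by elim: t off => [|l IHl r IHr] off //=; do 2![case: ifP => // _]. Qed.

Lemma branchR_subtree t off i :
  branchR t off i = rspine (subtree_at t off i).1 (subtree_at t off i).2.
Proof. by elim: t off => [|l IHl r IHr] off //=; do 2![case: ifP => // _]. Qed.

(** Induction along the search path: a left turn puts the root into [A] and the right subtree into
    [B]; a right turn puts the root and the left subtree into [A]. The labels just below and just
    above the interval are the ancestors at the last right and the last left turn. *)
Lemma subtree_context t off i : off < i <= off + tsize t ->
  exists l r o A B,
  [/\ subtree_at t off i = (BNode l r, o), i = o + tsize l + 1,
      pre t off = A ++ pre (BNode l r) o ++ B,
      {in A, forall x, off < x <= o \/ o + tsize (BNode l r) < x}
    & [/\ {in B, forall x, o + tsize (BNode l r) < x},
          off <= o /\ o + tsize (BNode l r) <= off + tsize t,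
          off < o -> o \in A &
          o + tsize (BNode l r) < off + tsize t ->
          (o + tsize (BNode l r)).+1 \in A]].
Proof.
elim: t off => [|l IHl r IHr] off; first by rewrite /=; lia.
move=> hi; have /= := hi; move=> {}hi.
case: eqP => [->|/eqP hne].
  exists l, r, off, [::], [::]; split=> //=; first by rewrite cats0.
  by split=> //; lia.
case: ltnP => hlt.
  have [|l' [r' [o [A [B [h1 h2 h3 h4 [h5 h6 h7 h8]]]]]]] := IHl off.
    by lia.
  exists l', r', o, (off + tsize l + 1 :: A), (B ++ pre r (off + tsize l + 1)).
  rewrite h3 /= in h4 h5 h6 h7 h8 *; split=> //.
  - by rewrite -!catA /= -!catA.
  - by move=> x; rewrite in_cons => /orP[/eqP ->|/h4]; lia.
  - split.
    + by move=> x; rewrite mem_cat => /orP[/h5|]; rewrite ?mem_pre; lia.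
    + by lia.
    + by move=> h; rewrite in_cons h7 ?orbT.
    + move=> _; rewrite in_cons; case: (ltnP (o + (tsize l' + 1 + tsize r')) (off + tsize l)) => h.
        by rewrite h8 ?orbT.
      by apply/orP; left; lia.
have [|l' [r' [o [A [B [h1 h2 h3 h4 [h5 h6 h7 h8]]]]]]] := IHr (off + tsize l + 1).
  by lia.
exists l', r', o, (off + tsize l + 1 :: pre l off ++ A), B.
rewrite h3 /= in h4 h5 h6 h7 h8 *; split=> //.
- by rewrite -!catA.
- move=> x; rewrite in_cons mem_cat mem_pre => /orP[/eqP ->|/orP[|/h4]]; lia.
- split => //.
  + by lia.
  + move=> h; rewrite in_cons mem_cat; case: (ltnP (off + tsize l + 1) o) => h'.
      by rewrite h7 ?orbT.
    by apply/orP; left; lia.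
  + by move=> h; rewrite in_cons mem_cat h8 ?orbT //; lia.
Qed.

(** The splitting of the word at the subtree of [i], read through positions; the main interface
    between labels and preorder. *)
Lemma vertex_spec t i : 0 < i <= tsize t ->
  exists l r,
  [/\ subtree_at t 0 i = (BNode l r, lo t i), i = lo t i + tsize l + 1,
      hi t i = i + tsize r, hi t i <= tsize t
    & [/\ forall x, lo t i < x <= hi t i ->
            pos t x = pos t i + index x (pre (BNode l r) (lo t i)),
          forall x, 0 < x <= tsize t ->
            [\/ pos t x < pos t i /\ (x <= lo t i \/ hi t i < x),
                lo t i < x <= hi t i |
                hi t i < x /\ pos t i + tsize l + tsize r < pos t x],
          0 < lo t i -> pos t (lo t i) < pos t i &
          hi t i < tsize t -> pos t (hi t i).+1 < pos t i]].
Proof.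
move=> hi0; have [|l [r [o [A [B [h1 h2 h3 h4 [h5 h6 h7 h8]]]]]]] := @subtree_context t 0 i.
  by [].
exists l, r; rewrite /lo /hi /pos /tau h3 h1 [_.2]/= [_.1]/=.
set s := BNode l r in h3 h4 h5 h6 h7 h8 *.
have hin x : (x \in pre s o) = (o < x <= o + tsize s) by rewrite mem_pre.
have hs : tsize s = tsize l + 1 + tsize r by [].
have iA : (i \in A) = false by apply/negP => /h4; lia.
have pi0 : index i (A ++ pre s o ++ B) = size A.
  rewrite index_cat iA index_cat hin ifT; last by lia.
  by rewrite /= -h2 eqxx addn0.
have pA x : x \in A -> index x (A ++ pre s o ++ B) < size A.
  by move=> xA; rewrite index_cat xA index_mem.
rewrite pi0; split=> //; try lia; split.
- move=> x hx; have xA : (x \in A) = false by apply/negP => /h4; lia.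
  by rewrite index_cat xA index_cat hin hx.
- move=> x hx; have : x \in pre t 0 by rewrite mem_pre.
  rewrite h3 !mem_cat => /or3P[xA|xs|xB].
  + by apply: Or31; rewrite pA //; have := h4 _ xA; lia.
  + by apply: Or32; rewrite -hin.
  + have := h5 _ xB => ?.
    case: (boolP (x \in A)) => xA.
      by apply: Or31; rewrite pA //; lia.
    apply: Or33; rewrite index_cat (negbTE xA) index_cat hin ifF; last by lia.
    split=> //; rewrite size_pre hs -!addnA ltn_add2l.
    by move: (tsize l) (tsize r) (index x B) => *; lia.
- by move=> h; apply: pA; apply: h7.
- by move=> h; apply: pA; apply: h8.
Qed.

Lemma mem_tau t x : (x \in tau t) = (0 < x <= tsize t).
Proof. exact: mem_pre. Qed.

Lemma pos_inj t x y : 0 < x <= tsize t -> pos t x = pos t y -> x = y.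
Proof.
rewrite -mem_tau /pos => hx e.
have hy : y \in tau t by rewrite -index_mem -e index_mem.
by rewrite -(nth_index 0 hx) e nth_index.
Qed.

Lemma pos_lt t x : 0 < x <= tsize t -> pos t x < tsize t.
Proof. exact: index_pre_lt. Qed.

Lemma lo_lt t i : 0 < i <= tsize t -> lo t i < i.
Proof. by move=> /vertex_spec[l [r []]]; lia. Qed.

Lemma hi_ge t i : 0 < i <= tsize t -> i <= hi t i <= tsize t.
Proof. by move=> /vertex_spec[l [r []]]; lia. Qed.

Lemma pos_lo t i : 0 < i <= tsize t -> 0 < lo t i -> pos t (lo t i) < pos t i.
Proof. by move=> /vertex_spec[l [r [_ _ _ _ []]]]. Qed.

Lemma pos_hi t i : 0 < i <= tsize t -> hi t i < tsize t ->
  pos t (hi t i).+1 < pos t i.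
Proof. by move=> /vertex_spec[l [r [_ _ _ _ []]]]. Qed.

Lemma pos_subtree t i x : 0 < i <= tsize t -> lo t i < x <= hi t i ->
  pos t i <= pos t x.
Proof.
by move=> /vertex_spec[l [r [_ _ _ _ [h _ _ _]]]] /h ->; rewrite leq_addr.
Qed.

Lemma lo_lt_later t i x : 0 < i <= tsize t -> 0 < x <= tsize t ->
  pos t i <= pos t x -> lo t i < x.
Proof.
move=> hi0 hx; have [l [r [_ ? ? _ [h1 h2 _ _]]]] := vertex_spec hi0.
by case: (h2 x hx); lia.
Qed.

(** A smaller [c] after [a] lies in the left subtree of [a], so among the first [tsize l] vertices
    after [a]. A larger [b] after [a] lies in the right subtree or behind the whole subtree, hence
    after [c]. *)
Lemma pos_231 t a b c :
  0 < a <= tsize t -> 0 < b <= tsize t -> 0 < c <= tsize t ->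
  pos t a < pos t b -> pos t b < pos t c -> c < a < b -> False.
Proof.
move=> ha hb hc ab bc cab; have [l [r [_ e1 e2 _ [h1 h2 _ _]]]] := vertex_spec ha.
have hc' := lo_lt_later ha hc.
have pc : pos t c <= pos t a + tsize l.
  rewrite h1 /=; last by lia.
  rewrite ifF; last by lia.
  have cl : c \in pre l (lo t a) by rewrite mem_pre; lia.
  rewrite index_cat cl; move: cl; rewrite mem_pre => /index_pre_lt.
  by rewrite leq_add2l.
case: (h2 b hb); [lia | move=> hb' | lia].
move: bc; rewrite [pos t b]h1 /=; last by lia.
rewrite ifF; last by lia.
rewrite index_cat ifF; last by rewrite mem_pre; lia.
by rewrite size_pre; lia.
Qed.

(** * Children and the subtrees below them *)

Lemma mem_lsub t i x : 0 < i <= tsize t ->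
  (x \in lsub t 0 i) = (lo t i < x < i).
Proof.
move=> hi0; have [l [r [e0 e1 e2 _ _]]] := vertex_spec hi0.
by rewrite lsub_subtree e0 mem_iota; lia.
Qed.

Lemma mem_rsub t i x : 0 < i <= tsize t ->
  (x \in rsub t 0 i) = (i < x <= hi t i).
Proof.
move=> hi0; have [l [r [e0 e1 e2 _ _]]] := vertex_spec hi0.
by rewrite rsub_subtree e0 mem_iota; lia.
Qed.

Lemma root_at_None t off : root_at t off = None -> tsize t = 0.
Proof. by case: t. Qed.

Lemma root_at_Some t off u : root_at t off = Some u ->
  off < u <= off + tsize t /\ index u (pre t off) = 0.
Proof. by case: t => //= l r [<-]; rewrite eqxx; lia. Qed.

Lemma lch_Some t i u : 0 < i <= tsize t -> lch t 0 i = Some u ->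
  lo t i < u < i /\ pos t u = (pos t i).+1.
Proof.
move=> hi0; have [l [r [e0 e1 e2 _ [h1 _ _ _]]]] := vertex_spec hi0.
rewrite lch_subtree e0 => /root_at_Some[hu pu]; split; first by lia.
rewrite h1 /=; last by lia.
by rewrite ifF ?index_cat ?mem_pre ?hu ?pu; lia.
Qed.

Lemma lch_ex t i x : 0 < i <= tsize t -> lo t i < x < i ->
  exists u, lch t 0 i = Some u.
Proof.
move=> hi0; have [l [r [e0 e1 e2 _ _]]] := vertex_spec hi0.
rewrite lch_subtree e0; case e: root_at => [u|]; first by exists u.
by move/root_at_None: e; lia.
Qed.

(** Between [i] and its right child the preorder word lists exactly the left subtree of [i]. *)
Lemma rch_Some t i u : 0 < i <= tsize t -> rch t 0 i = Some u ->
  [/\ i < u <= hi t i,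
      forall x, i < x <= hi t i -> pos t u <= pos t x &
      forall x, 0 < x <= tsize t -> pos t i < pos t x < pos t u -> x < i].
Proof.
move=> hi0; have [l [r [e0 e1 e2 _ [h1 h2 _ _]]]] := vertex_spec hi0.
rewrite rch_subtree e0 -e1 => /root_at_Some[hu pu].
have hr x : i < x <= hi t i -> pos t x = pos t i + (tsize l + index x (pre r i)).+1.
  move=> hx; rewrite h1 /=; last by lia.
  rewrite -e1 ifF; last by lia.
  by rewrite index_cat mem_pre ifF ?size_pre //; lia.
have pu' : pos t u = (pos t i + tsize l).+1 by rewrite hr ?pu; lia.
split; first by lia.
  by move=> x /hr; lia.
move=> x hx hp; case: (h2 x hx); [lia | move=> hx' | lia].
case: (ltngtP x i) => // hxi; last by move: hp; rewrite hxi ltnn.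
by move: (hr x); lia.
Qed.

Lemma rch_ex t i x : 0 < i <= tsize t -> i < x <= hi t i ->
  exists u, rch t 0 i = Some u.
Proof.
move=> hi0; have [l [r [e0 e1 e2 _ _]]] := vertex_spec hi0.
rewrite rch_subtree e0; case e: root_at => [u|]; first by exists u.
by move/root_at_None: e; lia.
Qed.

Lemma parent_ex t off j : off < j <= off + tsize t ->
  root_at t off = Some j \/
  exists2 p, off < p <= off + tsize t & lch t off p = Some j \/ rch t off p = Some j.
Proof.
elim: t off => [|l IHl r IHr] off /=; first by lia.
move=> hj; set v := off + tsize l + 1.
case: (ltngtP j v) => [jv|jv|->]; last by left.
  right; have [|e|[p hp e]] := IHl off; first by lia.
    by exists v; rewrite ?eqxx; [lia|left].
  exists p; first by lia.
  by have [-> ->] : (p == v) = false /\ (p < v) = true by lia.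
right; have [|e|[p hp e]] := IHr v; first by lia.
  by exists v; rewrite ?eqxx; [lia|right].
exists p; first by lia.
by have [-> ->] : (p == v) = false /\ (p < v) = false by lia.
Qed.

(** * Right branches *)

(** The last branch vertex carries the largest label, so dropping it makes the upper bound on [j]
    strict. A [j] in the left subtree fails because of the root; below the right child, the root and
    the left subtree are earlier and smaller, so only the right subtree matters. *)
Lemma mem_rspine_belast t off j :
  j \in take (size (rspine t off)).-1 (rspine t off) <->
  off < j < off + tsize t /\
  forall b, off < b <= off + tsize t ->
    index b (pre t off) < index j (pre t off) -> b < j.
Proof.
elim: t off => [|l _ r IHr] off /=; first by rewrite in_nil; split=> //; lia.
set v := off + tsize l + 1.
have pl b : off < b < v -> index b (pre l off ++ pre r v) < tsize l.
  move=> hb; have bl : b \in pre l off by rewrite mem_pre; lia.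
  by rewrite index_cat bl; apply: index_pre_lt; rewrite -mem_pre.
have pr b : v < b -> index b (pre l off ++ pre r v) = tsize l + index b (pre r v).
  move=> hb; have bl : (b \in pre l off) = false by rewrite mem_pre; lia.
  by rewrite index_cat bl size_pre.
(* With an empty right subtree the root itself is the vertex removed, and the strict bound forces
   [j] into the left subtree. *)
case er : (rspine r v) => [|w s] /=.
  have -> : tsize r = 0 by case: (r) er.
  rewrite in_nil; split=> // -[hj /(_ v)].
  by rewrite eqxx; case: eqP => [|_]; lia.
have := IHr v; rewrite er /= in_cons => {}IHr.
have r0 : 0 < tsize r by case: (r) er => //= *; lia.
split.
- case/orP => [/eqP ->|/IHr [hj hb]]; first by rewrite eqxx; split=> //; lia.
  split; first by lia.
  move=> b hb0; have -> : (v == j) = false by lia.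
  case: (ltngtP b v) => [|vb|->]; [lia| |lia].
  rewrite !pr; try lia.
  by rewrite ltnS ltn_add2l; apply: hb; lia.
- move=> [hj hb]; apply/orP.
  case: (ltngtP j v) => [jv|jv|->]; [|right|by left].
    have := hb v; rewrite eqxx; have -> : (v == j) = false by lia.
    by lia.
  apply/IHr; split; first by lia.
  move=> b hb0 hlt; apply: hb; first by lia.
  have [-> ->] : (v == b) = false /\ (v == j) = false by lia.
  by rewrite !pr ?ltnS ?ltn_add2l //; lia.
Qed.

(* The right branch of [i] consists of the left-to-right maxima of the preorder
   word of its subtree. *)
Lemma mem_branchR_minus t i j : 0 < i <= tsize t ->
  j \in branchR_minus t i <->
  lo t i < j < hi t i /\
  forall b, lo t i < b <= hi t i -> pos t b < pos t j -> b < j.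
Proof.
move=> hi0; have [l [r [e0 e1 e2 _ [h1 h2 _ _]]]] := vertex_spec hi0.
rewrite /branchR_minus branchR_subtree e0 [_.1]/= [_.2]/=.
have eh : hi t i = lo t i + tsize (BNode l r) by rewrite /=; lia.
apply: iff_trans; first exact: mem_rspine_belast.
rewrite -eh; split=> -[hj hb]; split=> // b hb0.
  by rewrite (h1 b) // (h1 j) ?ltn_add2l; [exact: hb|lia].
by move=> hlt; apply: hb => //; rewrite (h1 b) // (h1 j) ?ltn_add2l //; lia.
Qed.

(** * The preorder word as a permutation *)

Lemma size_tau t : size (tau t) = tsize t.
Proof. exact: size_pre. Qed.

Lemma tau_uniq t : uniq (tau t).
Proof. exact: pre_uniq. Qed.

Lemma perm_tau t : perm_eq (tau t) (iota 1 (tsize t)).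
Proof.
apply: uniq_perm; rewrite ?tau_uniq ?iota_uniq // => x.
by rewrite mem_tau mem_iota add1n ltnS.
Qed.

Lemma pval_pos t x : 0 < x <= tsize t -> pval (tau t) (pos t x).+1 = x.
Proof. by rewrite -mem_tau => hx; rewrite /pval /= nth_index. Qed.

Lemma pos_nth t b : b < tsize t -> pos t (nth 0 (tau t) b) = b.
Proof. by move=> hb; rewrite /pos index_uniq ?tau_uniq ?size_tau. Qed.

Lemma nth_tau_range t b : b < tsize t -> 0 < nth 0 (tau t) b <= tsize t.
Proof. by move=> hb; rewrite -mem_tau mem_nth ?size_tau. Qed.

(** * Mesh containment in terms of vertex maps *)

Lemma sorted_ltn_nth_leq s a b : sorted ltn s -> a <= b -> b < size s ->
  nth 0 s a <= nth 0 s b.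
Proof.
move=> hs ab bs; case: (ltngtP a b) ab => // [ab _|-> //].
by apply/ltnW/(sorted_ltn_nth ltn_trans 0 hs); rewrite ?inE //; lia.
Qed.

Lemma nth_cons0_lt d s a x : sorted ltn s -> a <= size s -> 0 < x ->
  nth d (0 :: s) a < x <-> (forall b, b < size s -> b < a -> nth 0 s b < x).
Proof.
move=> hs ha hx; case: a ha => [|a] ha /=; first by split.
rewrite (set_nth_default 0) //; split=> [h b hb ba|]; last exact.
by apply: leq_ltn_trans h; apply: sorted_ltn_nth_leq.
Qed.

(** The default [n.+1] is the upper boundary value of the grid: past the end of [s] both sides hold,
    the right one vacuously. *)
Lemma lt_nth_iff n s a x : sorted ltn s -> x <= n ->
  x < nth n.+1 s a <-> (forall b, b < size s -> a <= b -> x < nth 0 s b).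
Proof.
move=> hs hx; case: (ltnP a (size s)) => ha.
  rewrite (set_nth_default 0) //; split=> [h b hb ab|]; last exact.
  by apply: leq_trans h _; apply: sorted_ltn_nth_leq.
by rewrite nth_default //; split=> // _ b; lia.
Qed.

(* The cell with lower left corner [(a, j)] contains no vertex of [T], where
   [f] maps the pattern vertices to those of [T]. *)
Definition cell_free T P (f : nat -> nat) a j := forall x, 0 < x <= tsize T ->
  (forall i, 0 < i <= tsize P -> pos P i < a -> pos T (f i) < pos T x) ->
  (forall i, 0 < i <= tsize P -> a <= pos P i -> pos T x < pos T (f i)) ->
  (forall i, 0 < i <= j -> f i < x) ->
  (forall i, j < i <= tsize P -> x < f i) -> False.

(** An occurrence of the classical pattern [tau P] in [tau T], recorded as a map of vertices instead
    of a list of positions. *)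
Definition biorder_embedding T P (f : nat -> nat) :=
  [/\ forall i, 0 < i <= tsize P -> 0 < f i <= tsize T,
      forall i j, 0 < i <= tsize P -> 0 < j <= tsize P -> i < j -> f i < f j
    & forall i j, 0 < i <= tsize P -> 0 < j <= tsize P ->
        pos P i < pos P j -> pos T (f i) < pos T (f j)].

(** Both [nu] and the sorted values are increasing, so each side of the cell amounts to a comparison
    with all pattern vertices on that side; [c1] to [c4] treat the four sides. *)
Lemma cell_freeE T P f a j (nu := [seq (pos T (f i)).+1 | i <- tau P]) :
  biorder_embedding T P f -> a <= tsize P -> j <= tsize P ->
  (forall x, 0 < x <= tsize T ->
     ~~ ((nth (tsize T).+1 (0 :: nu) a < x < nth (tsize T).+1 (0 :: nu) a.+1) &&
        (nth (tsize T).+1 (0 :: sort leq [seq pval (tau T) x | x <- nu]) j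
         < pval (tau T) x <
         nth (tsize T).+1 (0 :: sort leq [seq pval (tau T) x | x <- nu]) j.+1)))
  <-> cell_free T P f a j.
Proof.
case=> fr fm fp ha hj; set lam := sort _ _.
have snu : size nu = tsize P by rewrite size_map size_tau.
have nnu b : b < tsize P -> nth 0 nu b = (pos T (f (nth 0 (tau P) b))).+1.
  by move=> hb; rewrite (nth_map 0) ?size_tau.
have snu' : sorted ltn nu.
  apply/(sortedP 0) => b; rewrite snu => hb; rewrite !nnu; try lia.
  rewrite /= ltnS; apply: fp; rewrite ?nth_tau_range ?pos_nth; lia.
(* Since [f] preserves the order of labels, sorting the values lists the images of 1, 2, ... in
   turn. *)
have elam : lam = [seq f i | i <- iota 1 (tsize P)].
  have -> : lam = sort leq [seq f i | i <- tau P].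
    rewrite /lam -map_comp; congr sort; apply/eq_in_map => i /=.
    by rewrite mem_tau => hi0; rewrite pval_pos ?fr.
  apply: (sorted_eq leq_trans anti_leq (sort_sorted leq_total _)).
    apply/(sortedP 0) => b; rewrite size_map size_iota => hb.
    rewrite !(nth_map 0) ?size_iota ?nth_iota //; try lia.
    by apply/ltnW/fm; lia.
  by rewrite perm_sort perm_map // perm_tau.
have slam : size lam = tsize P by rewrite elam size_map size_iota.
have nlam b : b < tsize P -> nth 0 lam b = f b.+1.
  by move=> hb; rewrite elam (nth_map 0) ?size_iota ?nth_iota ?add1n.
have slam' : sorted ltn lam.
  apply/(sortedP 0) => b; rewrite slam => hb; rewrite !nlam; try lia.
  by apply: fm; lia.
have c1 x : 0 < x -> nth (tsize T).+1 (0 :: nu) a < x <->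
    forall i, 0 < i <= tsize P -> pos P i < a -> (pos T (f i)).+1 < x.
  move=> x0; rewrite nth_cons0_lt ?snu //; split=> h.
    by move=> i hi0 hp; have := h _ (pos_lt hi0) hp; rewrite nnu ?pos_lt // nth_index ?mem_tau.
  by move=> b hb ba; rewrite nnu //; apply: h; rewrite ?nth_tau_range ?pos_nth.
have c2 x : x <= tsize T -> x < nth (tsize T).+1 (0 :: nu) a.+1 <->
    forall i, 0 < i <= tsize P -> a <= pos P i -> x < (pos T (f i)).+1.
  move=> x0; rewrite /= lt_nth_iff ?snu //; split=> h.
    by move=> i hi0 hp; have := h _ (pos_lt hi0) hp; rewrite nnu ?pos_lt // nth_index ?mem_tau.
  by move=> b hb ba; rewrite nnu //; apply: h; rewrite ?nth_tau_range ?pos_nth.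
have c3 x : 0 < x -> nth (tsize T).+1 (0 :: lam) j < x <->
    forall i, 0 < i <= j -> f i < x.
  move=> x0; rewrite nth_cons0_lt ?slam //; split=> h.
    by case=> // i hi0; have := h i; rewrite nlam; [apply; lia|lia].
  by move=> b hb ba; rewrite nlam //; apply: h; lia.
have c4 x : x <= tsize T -> x < nth (tsize T).+1 (0 :: lam) j.+1 <->
    forall i, j < i <= tsize P -> x < f i.
  move=> x0; rewrite /= lt_nth_iff ?slam //; split=> h.
    by case=> // i hi0; have := h i; rewrite nlam; [apply; lia|lia].
  by move=> b hb ba; rewrite nlam //; apply: h; lia.
split=> [h x hx h1 h2 h3 h4|h x hx].
  have px := pos_lt hx.
  move: (h (pos T x).+1); rewrite pval_pos // => /(_ _)/negP; apply; first by lia.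
  apply/andP; split; apply/andP; split.
  - by apply/c1 => // i hi0 hp; rewrite ltnS; exact: h1.
  - by apply/c2 => // i hi0 hp; rewrite ltnS; exact: h2.
  - by apply/c3 => //; lia.
  - by apply/c4 => //; lia.
(* Here [x] is a one-based position, while [cell_free] speaks of the vertex standing there. *)
have ex : pos T (pval (tau T) x) = x.-1 by rewrite /pval pos_nth; lia.
have hy : 0 < pval (tau T) x <= tsize T by apply: nth_tau_range; lia.
apply/negP => /andP[/andP[/c1 h1 /c2 h2] /andP[/c3 h3 /c4 h4]].
apply: (h _ hy); rewrite ?ex; last 2 first.
- by apply: h3; lia.
- by apply: h4; lia.
- by move=> i hi0 hp; have := h1 _ i hi0 hp; lia.
- by move=> i hi0 hp; have := h2 _ i hi0 hp; lia.
Qed.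

Lemma mcontains_tauP T P C :
  (forall ij, ij \in C -> ij.1 <= tsize P /\ ij.2 <= tsize P) ->
  mcontains (tau T) (tau P) C <->
  exists2 f, biorder_embedding T P f & forall ij, ij \in C -> cell_free T P f ij.1 ij.2.
Proof.
move=> hC; split.
- case=> nu; rewrite !size_tau => -[snu onu anu mnu bnu].
  have rnu b : b < tsize P -> 0 < nth 0 nu b <= tsize T.
    by rewrite -snu => hb; exact: (allP anu _ (mem_nth 0 hb)).
  (* The entries of [nu] follow the preorder of [P], so the one for [i] has index [pos P i]. *)
  pose f i := pval (tau T) (nth 0 nu (pos P i)).
  have pf i : 0 < i <= tsize P -> (pos T (f i)).+1 = nth 0 nu (pos P i).
    by move=> /pos_lt /rnu hr; rewrite /f /pval pos_nth; lia.
  have ff : biorder_embedding T P f.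
    split.
    + by move=> i /pos_lt /rnu hr; apply: nth_tau_range; lia.
    + move=> i j hi0 hj ij; have := mnu _ _ (pos_lt hi0) (pos_lt hj).
      by rewrite -/(f i) -/(f j) /pos !nth_index ?mem_tau // ij.
    + move=> i j hi0 hj ij; rewrite -ltnS pf // pf //.
      by apply: (sorted_ltn_nth ltn_trans 0 onu); rewrite ?inE ?snu ?pos_lt.
  have enu : nu = [seq (pos T (f i)).+1 | i <- tau P].
    apply: (@eq_from_nth _ 0); first by rewrite size_map size_tau.
    rewrite snu => b hb; rewrite (nth_map 0) ?size_tau //.
    by rewrite pf ?nth_tau_range // pos_nth.
  exists f => // ij hij; have [h1 h2] := hC _ hij.
  by apply/cell_freeE => //; rewrite -enu; apply: bnu.
- case=> f ff hf; have [fr fm fp] := ff.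
  exists [seq (pos T (f i)).+1 | i <- tau P]; rewrite !size_tau.
  have nnu b : b < tsize P ->
      nth 0 [seq (pos T (f i)).+1 | i <- tau P] b = (pos T (f (nth 0 (tau P) b))).+1.
    by move=> hb; rewrite (nth_map 0) ?size_tau.
  split.
  + by rewrite size_map size_tau.
  + apply/(sortedP 0) => b; rewrite size_map size_tau => hb; rewrite !nnu; try lia.
    by rewrite /= ltnS; apply: fp; rewrite ?nth_tau_range ?pos_nth; lia.
  + by apply/allP => x /mapP[i]; rewrite mem_tau => /fr/pos_lt ? ->.
  + move=> a b ha hb; rewrite !nnu // !pval_pos; try by apply/fr/nth_tau_range.
    have := @fm (nth 0 (tau P) a) (nth 0 (tau P) b).
    have := @fm (nth 0 (tau P) b) (nth 0 (tau P) a).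
    rewrite !nth_tau_range // => /(_ isT isT) h1 /(_ isT isT) h2.
    case: (ltngtP (nth 0 (tau P) a) (nth 0 (tau P) b)) h1 h2 => [_ _|_ + _|->]; last by lia.
      exact.
    by move=> /(_ isT); lia.
  + move=> nuext lamext ij hij; have [h1 h2] := hC _ hij.
    exact/(cell_freeE ff h1 h2)/hf.
Qed.

(** * The shaded cells of the mesh pattern *)

Lemma minl_iota o s : 0 < s -> minl (iota o.+1 s) = o.+1.
Proof.
case: s => // s _; rewrite /minl [head _ _]/=.
have : all (leq o.+1) (iota o.+1 s.+1) by apply/allP => x; rewrite mem_iota => /andP[].
by elim: (iota o.+1 s.+1) => //= x u IH /andP[hx /IH ->]; apply/minn_idPr.
Qed.

Lemma maxl_iota o s : 0 < s -> maxl (iota o.+1 s) = o + s.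
Proof.
rewrite /maxl; elim: s o => // -[|s] IH o _; first by rewrite /= maxn0 addn1.
by move: (IH o.+1 isT); rewrite /= => ->; lia.
Qed.

Lemma subl_lo_hi t i : subl t 0 i = iota (lo t i).+1 (hi t i - lo t i).
Proof. by rewrite subl_subtree /hi addKn. Qed.

(** As the labels below [i] form the interval []lo P i, hi P i]], the rows given by their minimum
    minus one and their maximum are its two ends. *)
Lemma mem_sigmaC P e ij : ij \in sigmaC P e <->
  exists i, [/\ 0 < i <= tsize P, ij.1 = pos P i &
    ij.2 \in branchR_minus P i \/
    [/\ troot P != Some i, e i & ij.2 = lo P i \/ ij.2 = hi P i]].
Proof.
have mm i : 0 < i <= tsize P ->
    (minl (subl P 0 i)).-1 = lo P i /\ maxl (subl P 0 i) = hi P i.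
  move=> hi0; have := lo_lt hi0; have := hi_ge hi0 => h1 h2.
  by rewrite subl_lo_hi minl_iota ?maxl_iota; lia.
split.
- case/flattenP => s /mapP[i]; rewrite mem_iota add1n ltnS => hi0 ->.
  have [e1 e2] := mm i hi0; rewrite e1 e2 mem_cat => /orP[/mapP[j hj ->]|].
    by exists i; split=> //; left.
  case: ifP => // /andP[h1 h2]; rewrite !inE => /orP[]/eqP ->.
    by exists i; split=> //; right; split=> //; left.
  by exists i; split=> //; right; split=> //; right.
- case=> i [hi0 h1 h2]; apply/flattenP.
  eexists; first by apply/mapP; exists i; [rewrite mem_iota add1n ltnS|reflexivity].
  have [e1 e2] := mm i hi0; rewrite e1 e2 mem_cat (surjective_pairing ij) h1.
  case: h2 => [h2|[-> -> h2]]; apply/orP; [left|right].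
    by apply/mapP; exists ij.2.
  by rewrite !inE /pos /=; case: h2 => ->; rewrite eqxx ?orbT.
Qed.

(** * Nested subtrees and common ancestors *)

(** Otherwise the subtree of [x] would contain [lo t i] or [i], both of which precede [x]. *)
Lemma lsub_nested t i x : 0 < i <= tsize t -> lo t i < x < i ->
  lo t i <= lo t x /\ hi t x < i.
Proof.
move=> hi0 hx; have hiB := hi_ge hi0.
have hx0 : 0 < x <= tsize t by lia.
have hxB := hi_ge hx0; have lx := lo_lt hx0; have li := lo_lt hi0.
have p1 : pos t i <= pos t x by apply: pos_subtree; lia.
have hne : pos t x <> pos t i by move/(pos_inj hx0); lia.
split; rewrite leqNgt; apply/negP => h.
  have := pos_lo hi0; have := @pos_subtree t x (lo t i) hx0; lia.
by have := @pos_subtree t x i hx0; lia.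
Qed.

Lemma rsub_nested t i x : 0 < i <= tsize t -> i < x <= hi t i ->
  i <= lo t x /\ hi t x <= hi t i.
Proof.
move=> hi0 hx; have hiB := hi_ge hi0.
have hx0 : 0 < x <= tsize t by lia.
have hxB := hi_ge hx0; have lx := lo_lt hx0; have li := lo_lt hi0.
have p1 : pos t i <= pos t x by apply: pos_subtree; lia.
have hne : pos t x <> pos t i by move/(pos_inj hx0); lia.
split; rewrite leqNgt; apply/negP => h.
  by have := @pos_subtree t x i hx0; lia.
have := pos_hi hi0; have := @pos_subtree t x (hi t i).+1 hx0; lia.
Qed.

(** Allows induction upwards within the subtree of [p]. If [j] is a left child and its parent [q]
    exceeded [hi t p], then [(hi t p).+1], [q], [j] would form a 231; if [j] is a right child, then
    [q < j] gives the upper bound. *)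
Lemma subtree_parent t p j : 0 < p <= tsize t -> lo t p < j <= hi t p -> j <> p ->
  exists2 q, 0 < q <= tsize t &
    [/\ lo t p < q <= hi t p, pos t q < pos t j &
        lch t 0 q = Some j \/ rch t 0 q = Some j].
Proof.
move=> hp0 hj jp; have hpB := hi_ge hp0.
have hj0 : 0 < j <= tsize t by lia.
have ppj : pos t p <= pos t j by exact: pos_subtree.
have pne : pos t j <> pos t p by move/(pos_inj hj0).
have [e|[q hq0 hq]] := @parent_ex t 0 j hj0.
  by have [_] := root_at_Some e; rewrite -/(tau t) -/(pos t j); lia.
exists q => //; case: hq => e; split; auto.
- have [h1 h2] := lch_Some hq0 e.
  have := lo_lt_later hp0 hq0; suff : q <= hi t p by lia.
  rewrite leqNgt; apply/negP => h.
  have h3 : pos t (hi t p).+1 < pos t p by apply: pos_hi; lia.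
  have ? : (hi t p).+1 <> q by move=> E; move: h3; rewrite E; lia.
  by apply: (@pos_231 t (hi t p).+1 q j); lia.
- by have [h1 h2] := lch_Some hq0 e; lia.
- have [h1 _ h2] := rch_Some hq0 e.
  case: (leqP (pos t p) (pos t q)) => h3; first by have := lo_lt_later hp0 hq0 h3; lia.
  by have := h2 p hp0; have := lo_lt hp0; lia.
- have [h1 _ h2] := rch_Some hq0 e.
  have := @pos_subtree t q j hq0; have := lo_lt hq0.
  have ? : pos t j <> pos t q by move/(pos_inj hj0); lia.
  by lia.
Qed.

(** For [g] the preorder position, the minimizer is the lowest common ancestor of [i] and [j]. *)
Lemma argmin_interval (g : nat -> nat) i j : i <= j ->
  exists2 q, i <= q <= j & forall x, i <= x <= j -> g q <= g x.
Proof.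
elim: j => [|j IH] ij; first by exists 0 => [|x hx]; [lia|have -> : x = 0 by lia].
case: (ltngtP i j.+1) ij => // [h _|-> _]; last first.
  by exists j.+1 => [|x hx]; [lia|have -> : x = j.+1 by lia].
have [|q hq hm] := IH; first by lia.
case: (leqP (g q) (g j.+1)) => hg; [exists q|exists j.+1]; try lia.
  by move=> x hx; case: (ltngtP x j.+1) => [?|?|-> //]; [apply: hm; lia|lia].
move=> x hx; case: (ltngtP x j.+1) => [?|?|-> //]; last by lia.
by apply: leq_trans (ltnW hg) _; apply: hm; lia.
Qed.

(** * From tree occurrences to mesh occurrences *)

Section TreeToMesh.
Variables (T P : btree) (e : nat -> bool) (f : nat -> nat).
Hypothesis fr : forall i, 0 < i <= tsize P -> 0 < f i <= tsize T.
Hypothesis fl : forall p i, 0 < p <= tsize P -> lch P 0 p = Some i ->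
  if e i then lch T 0 (f p) = Some (f i) else f i \in lsub T 0 (f p).
Hypothesis frt : forall p i, 0 < p <= tsize P -> rch P 0 p = Some i ->
  if e i then rch T 0 (f p) = Some (f i) else f i \in rsub T 0 (f p).

Let fl_sub p i : 0 < p <= tsize P -> lch P 0 p = Some i -> lo T (f p) < f i < f p.
Proof.
move=> hp h; have := fl hp h; case: (e i); last by rewrite mem_lsub ?fr.
by move/lch_Some => /(_ (fr hp))[].
Qed.

Let frt_sub p i : 0 < p <= tsize P -> rch P 0 p = Some i -> f p < f i <= hi T (f p).
Proof.
move=> hp h; have := frt hp h; case: (e i); last by rewrite mem_rsub ?fr.
by move/rch_Some => /(_ (fr hp))[].
Qed.

(** Edge conditions only relate a child to its parent. Induction on the position of [j] passes to
    the parent [q] of [j]: the image of [q] is on the correct side of [f p], and nesting carries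
    this over to [f j]. *)
Lemma embedding_sub p j : 0 < p <= tsize P ->
  (lo P p < j < p -> lo T (f p) < f j < f p) /\
  (p < j <= hi P p -> f p < f j <= hi T (f p)).
Proof.
move=> hp; have [n] := ubnP (pos P j); elim: n j => // n IH j hn.
suff H : lo P p < j <= hi P p -> j <> p ->
    (j < p -> lo T (f p) < f j < f p) /\ (p < j -> f p < f j <= hi T (f p)).
  by have := lo_lt hp; have := hi_ge hp; split=> h; apply H; lia.
move=> hj jp; have [q hq [h1 h2 h3]] := subtree_parent hp hj jp.
have hfp := fr hp; have hfq := fr hq.
have lq := lo_lt hq; have hiq := hi_ge hq.
have sq : lo P q < j <= hi P q /\ j <> q.
  by case: h3 => [/(lch_Some hq)|/(rch_Some hq)] []; lia.
have sfq : lo T (f q) < f j <= hi T (f q).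
  have := lo_lt hfq; have := hi_ge hfq.
  by case: h3 => [/(fl_sub hq)|/(frt_sub hq)]; lia.
case: (ltngtP q p) => qp.
- have [IHl _] := IH q (ltac:(lia)).
  have h4 : lo T (f p) < f q < f p by apply: IHl; lia.
  have := lsub_nested hfp h4.
  have : lo P p < q < p by lia.
  by move/(lsub_nested hp); lia.
- have [_ IHr] := IH q (ltac:(lia)).
  have h4 : f p < f q <= hi T (f p) by apply: IHr; lia.
  have := rsub_nested hfp h4.
  have : p < q <= hi P p by lia.
  by move/(rsub_nested hp); lia.
- subst q; case: h3 => h3.
    by have := fl_sub hp h3; have := lch_Some hp h3; lia.
  by have := frt_sub hp h3; have := rch_Some hp h3 => -[]; lia.
Qed.

(** Let [q] be the lowest common ancestor. If [q] is neither [i] nor [j], they lie on different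
    sides of it and so do their images; 231-avoidance then puts the left vertex first in both trees.
    If [q] is [i] or [j], it precedes the other one, also after mapping. *)
Lemma embedding_pair i j : 0 < i <= tsize P -> 0 < j <= tsize P -> i < j ->
  [/\ f i < f j, pos P i < pos P j -> pos T (f i) < pos T (f j) &
      pos P j < pos P i -> pos T (f j) < pos T (f i)].
Proof.
move=> hi0 hj0 ij; have [q hq hm] := argmin_interval (pos P) (ltnW ij).
have hq0 : 0 < q <= tsize P by lia.
have hqi := hm i (ltac:(lia)); have hqj := hm j (ltac:(lia)).
have li := lo_lt_later hq0 hi0 hqi.
(* Otherwise [(hi P q).+1] lies between [i] and [j] and precedes [q], against minimality. *)
have hj : j <= hi P q.
  rewrite leqNgt; apply/negP => h.
  by have := pos_hi hq0; have := hm (hi P q).+1; have := hi_ge hq0; lia.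
have hfi := fr hi0; have hfj := fr hj0; have hfq := fr hq0.
have [fqi _] := @embedding_sub q i hq0; have [_ fqj] := @embedding_sub q j hq0.
have nij : pos P i <> pos P j by move/(pos_inj hi0); lia.
have lfq := lo_lt hfq; have hfqB := hi_ge hfq.
have eqi : q = i \/ (lo T (f q) < f i < f q /\ q <> i).
  by case: (ltngtP i q) => [h| |->]; [right; split; [apply: fqi|]; lia|lia|left].
have eqj : q = j \/ (f q < f j <= hi T (f q) /\ q <> j).
  by case: (ltngtP q j) => [h| |->]; [right; split; [apply: fqj|]; lia|lia|left].
have fij : f i < f j by case: eqi => [?|[]]; case: eqj => [?|[]]; subst; lia.
have nfij : pos T (f i) <> pos T (f j) by move/(pos_inj hfi); lia.
have pfi : pos T (f q) <= pos T (f i).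
  by case: eqi => [-> //|[h _]]; apply: pos_subtree => //; lia.
have pfj : pos T (f q) <= pos T (f j).
  by case: eqj => [-> //|[h _]]; apply: pos_subtree => //; lia.
split=> // hlt.
- case: eqj => [E|[hj' qj]]; first by move: hqi; rewrite E; lia.
  case: eqi => [E|[hi' qi]]; first by move: pfj; rewrite E; lia.
  have ? : pos T (f q) <> pos T (f j) by move/(pos_inj hfq); lia.
  rewrite ltnNge; apply/negP => h.
  by apply: (@pos_231 T (f q) (f j) (f i)); lia.
- case: eqi => [E|[hi' qi]]; first by move: hqj; rewrite E; lia.
  case: eqj => [E|[hj' qj]]; first by move: pfi; rewrite E; lia.
  have ? : pos P q <> pos P j by move/(pos_inj hq0); lia.
  by case: (@pos_231 P q j i); lia.
Qed.

Lemma embedding_biorder : biorder_embedding T P f.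
Proof.
split=> // i j hi0 hj0 ij; first by have [] := embedding_pair hi0 hj0 ij.
case: (ltngtP i j) => [h|h|E]; last by move: ij; rewrite E ltnn.
  by have [_ + _] := embedding_pair hi0 hj0 h; apply.
by have [_ _] := embedding_pair hj0 hi0 h; apply.
Qed.

Lemma embedding_cell_free ij : ij \in sigmaC P e -> cell_free T P f ij.1 ij.2.
Proof.
case/mem_sigmaC => i [hi0 -> hC] x hx hb ha hlo hhi.
have hfi := fr hi0.
have pxi : pos T x < pos T (f i) by exact: ha.
have lih := lo_lt hi0; have hih := hi_ge hi0.
case: hC => [|[nr ei hC]].
  (* Right-branch cell: both [ij.2] and its successor lie in the subtree of [i], which traps [x] in
     the subtree of [f i], although [x] precedes [f i]. *)
  case/(mem_branchR_minus _ hi0) => hj hB.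
  have ij2 : i <= ij.2.
    rewrite leqNgt; apply/negP => h.
    have p1 : pos P i <= pos P ij.2 by apply: pos_subtree; lia.
    have ? : pos P i <> pos P ij.2 by move/(pos_inj hi0); lia.
    by have := hB i; lia.
  have h1 : f i < x by apply: hlo; lia.
  have h2 : x < f ij.2.+1 by apply: hhi; lia.
  have [_ h3] := @embedding_sub i ij.2.+1 hi0.
  have := @pos_subtree T (f i) x hfi; have := lo_lt hfi; lia.
(* Edge cell: [x] lies in preorder between [f p] and its child [f i]. This is impossible for a left
   child; for a right child it gives [x < f p], whereas [p] is at most [lo P i] and so bounds [x]
   from below. *)
have [E|[p hp hpi]] := @parent_ex P 0 i hi0.
  by move: nr; rewrite /troot E eqxx.
have hfp := fr hp.
case: hpi => hpi.
  have [h1 h2] := lch_Some hp hpi.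
  have : pos T (f p) < pos T x by apply: hb => //; lia.
  by have := fl hp hpi; rewrite ei => /(lch_Some hfp)[]; lia.
have [h1 h2 h3] := rch_Some hp hpi.
have ppi : pos P p < pos P i.
  have ? : pos P p <> pos P i by move/(pos_inj hp); lia.
  by have := @pos_subtree P p i hp; have := lo_lt hp; lia.
have h4 : pos T (f p) < pos T x by apply: hb.
have := frt hp hpi; rewrite ei => /(rch_Some hfp)[_ _ h5].
have h6 : x < f p by apply: h5; lia.
have := rsub_nested hp h1.
by have := hlo p; case: hC => ->; lia.
Qed.

End TreeToMesh.

(** * From mesh occurrences to tree occurrences *)

Section MeshToTree.
Variables (T P : btree) (e : nat -> bool) (f : nat -> nat).
Hypothesis fbi : biorder_embedding T P f.
Hypothesis fcell : forall ij, ij \in sigmaC P e -> cell_free T P f ij.1 ij.2.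

Let fr i : 0 < i <= tsize P -> 0 < f i <= tsize T.
Proof. by have [+ _ _] := fbi; apply. Qed.

Let f_lt i j : 0 < i <= tsize P -> 0 < j <= tsize P -> i < j -> f i < f j.
Proof. by have [_ + _] := fbi; apply. Qed.

Let f_le i j : 0 < i <= tsize P -> 0 < j <= tsize P -> i <= j -> f i <= f j.
Proof.
by move=> hi0 hj; case: (ltngtP i j) => [h|//|-> //] _; apply/ltnW/f_lt.
Qed.

Let p_lt i j : 0 < i <= tsize P -> 0 < j <= tsize P ->
  pos P i < pos P j -> pos T (f i) < pos T (f j).
Proof. by have [_ _] := fbi; apply. Qed.

Let p_le i j : 0 < i <= tsize P -> 0 < j <= tsize P ->
  pos P i <= pos P j -> pos T (f i) <= pos T (f j).
Proof.
move=> hi0 hj; case: (ltngtP (pos P i) (pos P j)) => [h|//|E] _; first exact/ltnW/p_lt.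
by rewrite (pos_inj hi0 E).
Qed.

(* With [i'] the first pattern vertex whose image follows [q], the subtree of
   [i'] contains [i], since otherwise the vertex following that subtree gives an
   occurrence of 231; then [m] is on the right branch of [i'], again by
   231-avoidance, and [q] lies in the forbidden cell [(pos i', m)]. *)
Lemma mesh_no_gap i m q : 0 < i <= tsize P -> i <= m < hi P i -> 0 < q <= tsize T ->
  pos T q < pos T (f i) -> f m < q < f m.+1 -> False.
Proof.
move=> hi0 hm hq pq fq; have hiB := hi_ge hi0; have liB := lo_lt hi0.
pose A b := (b < tsize P) && (pos T q < pos T (f (nth 0 (tau P) b))).
have exA : exists b, A b.
  by exists (pos P i); rewrite /A pos_lt // nth_index ?mem_tau.
case: (ex_minnP exA) => b0 /andP[hb0 pb0] bmin.
set i' := nth 0 (tau P) b0 in pb0.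
have hi' : 0 < i' <= tsize P by exact: nth_tau_range.
have pi' : pos P i' = b0 by exact: pos_nth.
have first_i' j : 0 < j <= tsize P -> pos T q < pos T (f j) -> pos P i' <= pos P j.
  by move=> hj hqj; rewrite pi'; apply: bmin; rewrite /A pos_lt // nth_index ?mem_tau.
have q_notin j : 0 < j <= tsize P -> f j <> q.
  move=> hj E; have := @f_le j m; have := @f_le m.+1 j.
  by case: (leqP j m); lia.
have before j : 0 < j <= tsize P -> pos P j < pos P i' -> pos T (f j) < pos T q.
  move=> hj pj; have := first_i' j hj; have hfj := fr hj.
  have ? : pos T (f j) <> pos T q by move/(pos_inj hfj)/q_notin; apply.
  by lia.
have hiB' := hi_ge hi'; have liB' := lo_lt hi'.
have pii : pos P i' <= pos P i by exact: first_i'.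
have lo_i := lo_lt_later hi' hi0 pii.
have hi_i : i <= hi P i'.
  rewrite leqNgt; apply/negP => h; set h' := (hi P i').+1.
  have h'0 : 0 < h' <= tsize P by rewrite /h'; lia.
  have ph : pos P h' < pos P i' by apply: pos_hi; lia.
  have fh := before _ h'0 ph.
  have f1 : f i' < f h' by apply: f_lt; rewrite // /h'; lia.
  have f2 : f h' <= f m by apply: f_le; rewrite // /h'; lia.
  have hf1 := fr hi'; have hf2 := fr h'0.
  by apply: (@pos_231 T (f h') q (f i')); lia.
have nest : hi P i <= hi P i'.
  case: (ltngtP i i') => h; last by rewrite h.
    by have := @lsub_nested P i' i hi'; lia.
  by have := @rsub_nested P i' i hi'; lia.
have hm0 : 0 < m <= tsize P by lia.
have hm1 : 0 < m.+1 <= tsize P by lia.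
have brm : m \in branchR_minus P i'.
  apply/(mem_branchR_minus _ hi'); split; first by lia.
  move=> b hb pb; rewrite ltnNge; apply/negP => mb.
  have b0' : 0 < b <= tsize P by lia.
  have ? : b <> m by move=> E; move: pb; rewrite E ltnn.
  have f1 : f m.+1 <= f b by apply: f_le => //; lia.
  have f2 : pos T (f i') <= pos T (f b) by apply: p_le => //; exact: pos_subtree.
  have f3 : pos T (f b) < pos T (f m) by exact: p_lt.
  have hf1 := fr b0'; have hf2 := fr hm0.
  by apply: (@pos_231 T q (f b) (f m)); lia.
have : (pos P i', m) \in sigmaC P e.
  by apply/mem_sigmaC; exists i'; split=> //; left.
move/fcell => /(_ q hq) /=; apply=> //.
- by move=> j hj pj; apply: leq_trans pb0 _; exact: p_le.
- by move=> j hj; have := @f_le j m; lia.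
- by move=> j hj; have := @f_le m.+1 j; lia.
Qed.

(** Descending from [j] to [i] meets consecutive labels whose images enclose [q]; [q] is not an
    image itself, as it precedes [f i]. *)
Lemma mesh_sub i j q : 0 < i <= tsize P -> i < j <= hi P i -> 0 < q <= tsize T ->
  pos T q < pos T (f i) -> f i < q < f j -> False.
Proof.
move=> hi0 hj hq pq fq; have hiB := hi_ge hi0; have liB := lo_lt hi0.
elim: j hj fq => // j IH hj fq.
have hj1 : 0 < j <= tsize P by lia.
have fj := fr hj1.
case: (ltngtP q (f j)) => h.
- case: (ltngtP i j) => ij; [by apply: IH; lia|lia|].
  by move: fq h; rewrite ij; lia.
- by apply: (@mesh_no_gap i j q); lia.
- have : pos T (f i) <= pos T (f j).
    by apply: p_le => //; apply: pos_subtree; lia.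
  by rewrite -h; lia.
Qed.

(** Applied to a child [c] of the image of the parent of [i] lying strictly above [f i]: such a [c]
    falls into one of the two edge cells of [i], the lower one if [c < f i] and the upper one if
    [c > f i]. *)
Lemma mesh_consecutive i c : 0 < i <= tsize P -> troot P != Some i -> e i ->
  0 < c <= tsize T ->
  (forall j, 0 < j <= tsize P -> pos P j < pos P i -> pos T (f j) < pos T c) ->
  (0 < lo P i -> f (lo P i) < c) -> (hi P i < tsize P -> c < f (hi P i).+1) ->
  pos T c < pos T (f i) -> False.
Proof.
move=> hi0 nr ei hc before clo chi pc; have hiB := hi_ge hi0; have liB := lo_lt hi0.
have cell j : j = lo P i \/ j = hi P i -> cell_free T P f (pos P i) j.
  move=> hj; have /fcell // : (pos P i, j) \in sigmaC P e.
  by apply/mem_sigmaC; exists i; split=> //; right.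
have after j : 0 < j <= tsize P -> pos P i <= pos P j -> pos T c < pos T (f j).
  by move=> hj pj; apply: leq_trans pc _; exact: p_le.
have hfi := fr hi0.
case: (ltngtP c (f i)) => h; last by move: pc; rewrite h ltnn.
- apply: (cell (lo P i) _ c) => //; first by left.
    by move=> j hj; have := @f_le j (lo P i); lia.
  (* [l] is the smallest label in the subtree of [i]; if its image were below [c], then [c], [f i],
     [f l] would form a 231. *)
  move=> j hj; set l := (lo P i).+1.
  have hl : 0 < l <= tsize P by rewrite /l; lia.
  have hj0 : 0 < j <= tsize P by lia.
  apply: (@leq_trans (f l)); last by apply: f_le => //; rewrite /l; lia.
  have hfl := fr hl.
  have pil : pos P i <= pos P l by apply: pos_subtree; rewrite // /l; lia.
  have pcl := after l hl pil; have fpil := p_le hi0 hl pil.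
  rewrite ltnNge; apply/negP => hlc.
  have ? : f l <> c by move=> E; move: pcl; rewrite E ltnn.
  have ? : pos T (f i) <> pos T (f l) by move/(pos_inj hfi); lia.
  by apply: (@pos_231 T c (f i) (f l)); lia.
- apply: (cell (hi P i) _ c) => //; first by right.
    move=> j hj; set u := hi P i.
    have hu : 0 < u <= tsize P by rewrite /u; lia.
    have hj0 : 0 < j <= tsize P by lia.
    apply: (@leq_ltn_trans (f u)); first by apply: f_le; rewrite // /u; lia.
    have piu : pos P i <= pos P u by apply: pos_subtree; rewrite // /u; lia.
    have pcu := after u hu piu.
    have ? : f u <> c by move=> E; move: pcu; rewrite E ltnn.
    rewrite ltnNge; apply/negP => hcu.
    have ? : u <> i by move=> E; move: hcu; rewrite E; lia.
    have eu : u = hi P i by [].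
    by apply: (@mesh_sub i u c) => //; lia.
  by move=> j hj; have := @f_le (hi P i).+1 j; lia.
Qed.

Lemma not_root_pos t i p : 0 < i <= tsize t -> pos t p < pos t i -> troot t != Some i.
Proof.
move=> hi0 pp; apply/negP => /eqP /root_at_Some[_].
by rewrite -/(tau t) -/(pos t i); lia.
Qed.

(** Being smaller than [f p] and later in preorder puts [f i] into the left subtree of [f p]. If
    [e i] holds, a left child of [f p] other than [f i] would contradict [mesh_consecutive]. *)
Lemma mesh_lch p i : 0 < p <= tsize P -> lch P 0 p = Some i ->
  if e i then lch T 0 (f p) = Some (f i) else f i \in lsub T 0 (f p).
Proof.
move=> hp hpi; have [h1 h2] := lch_Some hp hpi.
have hi0 : 0 < i <= tsize P by lia.
have fip : f i < f p by apply: f_lt => //; lia.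
have pfpi : pos T (f p) < pos T (f i) by apply: p_lt => //; lia.
have hfi := fr hi0; have hfp := fr hp.
have sub : lo T (f p) < f i < f p.
  by have := lo_lt_later hfp hfi; lia.
case: ifP => ei; last by rewrite mem_lsub.
have [c hc] := lch_ex hfp sub; have [c1 c2] := lch_Some hfp hc; rewrite hc.
have hc0 : 0 < c <= tsize T by lia.
congr Some; apply/eqP/negPn/negP => /eqP cne.
have pcne : pos T c <> pos T (f i) by move/(pos_inj hc0).
have lP := lo_lt hp; have hiB := hi_ge hp; have := lsub_nested hp h1.
have liB := lo_lt hi0; have hiB' := hi_ge hi0 => nest.
have pne j : 0 < j <= tsize P -> j <> p -> pos P j <> pos P p.
  by move=> hj jp; move/(pos_inj hj).
apply: (@mesh_consecutive i c) => //; try lia.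
- by apply: (@not_root_pos P i p hi0); lia.
- move=> j hj pj; have : pos T (f j) <= pos T (f p) by apply: p_le; lia.
  by lia.
- move=> l0; have pl := pos_lo hi0 l0.
  have hl : 0 < lo P i <= tsize P by lia.
  have := pne _ hl; have hfl := fr hl => plp.
  have fl : f (lo P i) < f p by apply: f_lt => //; lia.
  have pfl : pos T (f (lo P i)) < pos T (f p) by apply: p_lt => //; lia.
  rewrite ltnNge; apply/negP => hcl.
  have ? : f (lo P i) <> c by move=> E; move: pfl; rewrite E; lia.
  by apply: (@pos_231 T (f (lo P i)) (f p) c); lia.
- move=> hu; have pu := pos_hi hi0 hu.
  have hu0 : 0 < (hi P i).+1 <= tsize P by lia.
  (* The label following the subtree of a left child is its parent; any other value gives a 231 in
     [P]. *)
  case: ((hi P i).+1 =P p) => [->|np]; first by lia.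
  have := pne _ hu0 np => ?.
  by case: (@pos_231 P (hi P i).+1 p i); lia.
Qed.

Lemma mesh_rch p i : 0 < p <= tsize P -> rch P 0 p = Some i ->
  if e i then rch T 0 (f p) = Some (f i) else f i \in rsub T 0 (f p).
Proof.
move=> hp hpi; have [h1 h2 h3] := rch_Some hp hpi.
have lP := lo_lt hp; have hiB := hi_ge hp.
have hi0 : 0 < i <= tsize P by lia.
have ppi : pos P p < pos P i.
  have ? : pos P p <> pos P i by move/(pos_inj hp); lia.
  by have := @pos_subtree P p i hp; lia.
have fip : f p < f i by apply: f_lt => //; lia.
have pfpi : pos T (f p) < pos T (f i) by exact: p_lt.
have hfi := fr hi0; have hfp := fr hp.
(* Otherwise the label following the subtree of [f p] precedes [f p] and lies between [f p] and
   [f i], which [mesh_sub] excludes. *)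
have sub : f p < f i <= hi T (f p).
  rewrite fip leqNgt; apply/negP => h; have pu := pos_hi hfp.
  have hu : hi T (f p) < tsize T by lia.
  have ? : (hi T (f p)).+1 <> f i by move=> E; move: pu; rewrite E; lia.
  by have := hi_ge hfp => ?; apply: (@mesh_sub p i (hi T (f p)).+1); lia.
case: ifP => ei; last by rewrite mem_rsub.
have [c hc] := rch_ex hfp sub; have [c1 c2 c3] := rch_Some hfp hc; rewrite hc.
have hfpB := hi_ge hfp; have lfpB := lo_lt hfp.
have hc0 : 0 < c <= tsize T by lia.
congr Some; apply/eqP/negPn/negP => /eqP cne.
have pcne : pos T c <> pos T (f i) by move/(pos_inj hc0).
have pci := c2 _ sub.
have pfpc : pos T (f p) < pos T c.
  have ? : pos T (f p) <> pos T c by move/(pos_inj hfp); lia.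
  by have := @pos_subtree T (f p) c hfp; lia.
have := rsub_nested hp h1; have liB := lo_lt hi0; have hiB' := hi_ge hi0 => nest.
apply: (@mesh_consecutive i c) => //; try lia.
- exact: (@not_root_pos P i p hi0).
(* A [j] after [p] and before [i] lies left of [p]; were [f j] after [c], then [f p], [c], [f j]
   would be a 231. *)
- move=> j hj pj; case: (leqP (pos P j) (pos P p)) => pjp.
    by have := p_le hj hp pjp; lia.
  have fjp : f j < f p by apply: f_lt => //; apply: h3; lia.
  have pfj := p_lt hp hj pjp; have hfj := fr hj.
  rewrite ltnNge; apply/negP => hcj.
  have ? : pos T c <> pos T (f j) by move/(pos_inj hc0); lia.
  by apply: (@pos_231 T (f p) c (f j)); lia.
- move=> l0; have pl := pos_lo hi0 l0.
  have hl : 0 < lo P i <= tsize P by lia.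
  case: (lo P i =P p) => [->|np]; first by lia.
  have := h3 _ hl; have := @pos_subtree P p (lo P i) hp.
  have ? : pos P (lo P i) <> pos P p by move/(pos_inj hl).
  by lia.
- move=> hu; have pu := pos_hi hi0 hu.
  have hu0 : 0 < (hi P i).+1 <= tsize P by lia.
  have ? : pos P (hi P i).+1 <> pos P p by move/(pos_inj hu0); lia.
  have pup : pos P (hi P i).+1 < pos P p by have := h3 _ hu0; lia.
  have fup := p_lt hu0 hp pup; have hfu := fr hu0.
  have fpu : f p < f (hi P i).+1 by apply: f_lt => //; lia.
  rewrite ltnNge; apply/negP => hcu.
  by have := @pos_subtree T (f p) (f (hi P i).+1) hfp; lia.
Qed.

End MeshToTree.

(** * Equivalence of the two notions of containment *)

Lemma tcontains_mcontains T P e :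
  tcontains T P e <-> mcontains (tau T) (tau P) (sigmaC P e).
Proof.
have rng (x n : nat) : (x \in iota 1 n) = (0 < x <= n) by rewrite mem_iota add1n ltnS.
apply: iff_trans; last apply: iff_sym; last apply: mcontains_tauP; last first.
  move=> [a j] /mem_sigmaC[i [/= hi0 -> h]]; have := pos_lt hi0; have := hi_ge hi0.
  have := lo_lt hi0 => ? ? ?; split; first by lia.
  by case: h => [/(mem_branchR_minus _ hi0)[+ _]|[_ _ [->|->]]]; lia.
split.
- case=> f [fr [_ fc]].
  have fr' i : 0 < i <= tsize P -> 0 < f i <= tsize T by rewrite -!rng; exact: fr.
  have crng p i : 0 < p <= tsize P -> lch P 0 p = Some i \/ rch P 0 p = Some i ->
      i \in iota 1 (tsize P).
    move=> hp hc; rewrite rng; have := hi_ge hp.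
    by case: hc => [/(lch_Some hp)|/(rch_Some hp)] []; lia.
  have fl p i : 0 < p <= tsize P -> lch P 0 p = Some i ->
      if e i then lch T 0 (f p) = Some (f i) else f i \in lsub T 0 (f p).
    move=> hp hc; have [||+ _] := fc p i; [by rewrite rng| |exact].
    by apply: (crng p) => //; left.
  have frt p i : 0 < p <= tsize P -> rch P 0 p = Some i ->
      if e i then rch T 0 (f p) = Some (f i) else f i \in rsub T 0 (f p).
    move=> hp hc; have [||_] := fc p i; [by rewrite rng| |exact].
    by apply: (crng p) => //; right.
  exists f; first exact: embedding_biorder fr' fl frt.
  by move=> ij; exact: embedding_cell_free fr' fl frt ij.
- case=> f fbi fcell; have [fr fm _] := fbi; exists f; split; last split.
  + by move=> i; rewrite !rng; exact: fr.
  + move=> i j; rewrite !rng => hi0 hj E.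
    by have := fm i j hi0 hj; have := fm j i hj hi0; lia.
  + move=> p i; rewrite !rng => hp _; split; first exact: mesh_lch.
    exact: mesh_rch.
Qed.

(** * Trees and 231-avoiding permutations *)

Lemma tau_avoids231 t : avoids231 (tau t).
Proof.
case=> -[|a [|b [|c [|? ?]]]] [] // _ /and3P[ab bc _].
rewrite size_tau => /and4P[ha hb hc _] h _.
have v x : 0 < x <= tsize t ->
    0 < pval (tau t) x <= tsize t /\ pos t (pval (tau t) x) = x.-1.
  by move=> hx; rewrite /pval; split; [apply: nth_tau_range|apply: pos_nth]; lia.
have [ra pa] := v _ ha; have [rb pb] := v _ hb; have [rc pc] := v _ hc.
have /= h1 := h 0 1 isT isT; have /= h2 := h 2 0 isT isT.
by apply: (pos_231 ra rb rc); rewrite ?pa ?pb ?pc ?h1 ?h2 /= in ab bc *; lia.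
Qed.

(** Links subsequences, which suit induction on words, to the one-based position lists of
    [mcontains]. *)
Lemma subseq_nth (s1 s2 : seq nat) : subseq s1 s2 ->
  exists nu, [/\ size nu = size s1, sorted ltn nu,
    all (fun x => 0 < x <= size s2) nu & map (pval s2) nu = s1].
Proof.
elim: s2 s1 => [|y s2 IH] s1; first by rewrite subseq0 => /eqP ->; exists [::].
have shift nu : sorted ltn nu -> all (fun x => 0 < x <= size s2) nu ->
    [/\ path ltn 1 (map S nu),
        all (fun x => 0 < x <= (size s2).+1) (map S nu) &
        map (pval (y :: s2)) (map S nu) = map (pval s2) nu].
  move=> sn an; split.
  - rewrite path_sortedE; last exact: ltn_trans.
    rewrite all_map sorted_map; apply/andP; split.
      by apply: sub_all an => x /=; lia.
    by apply: sub_sorted sn => x z.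
  - by rewrite all_map; apply: sub_all an => x /=; lia.
  - rewrite -map_comp; apply/eq_in_map => x /(allP an) /=.
    by rewrite /pval /=; case: x.
case: s1 => [|x s1]; first by exists [::].
rewrite /=; case: eqP => [->|_] /IH[nu [h1 h2 h3 h4]].
  have [g1 g2 g3] := shift _ h2 h3; exists (1 :: map S nu); split=> //.
  - by rewrite /= size_map h1.
  - by rewrite map_cons g3 h4.
have [g1 g2 g3] := shift _ h2 h3; exists (map S nu); split=> //.
- by rewrite size_map h1.
- exact: path_sorted g1.
- by rewrite g3 h4.
Qed.

Lemma avoids231_subseq pi a b c : avoids231 pi ->
  subseq [:: a; b; c] pi -> c < a < b -> False.
Proof.
move=> h /subseq_nth[[|x [|y [|z [|? ?]]]] [] // _ o1 o2 [ea eb ec]] cab.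
apply: h; exists [:: x; y; z]; split=> //.
by move=> [|[|[|i]]] [|[|[|j]]] //= _ _; rewrite ?ea ?eb ?ec; lia.
Qed.

Lemma split_by_pivot v s :
  (forall b c, subseq [:: b; c] s -> c < v < b -> False) -> v \notin s ->
  s = [seq x <- s | x < v] ++ [seq x <- s | v < x].
Proof.
elim: s => //= x s IH h; rewrite in_cons negb_or => /andP[vx vs].
have IH' : s = [seq x <- s | x < v] ++ [seq x <- s | v < x].
  apply: IH => // b c hs; apply: h; move: hs; case: ifP => // _.
  by move=> hs; apply: subseq_trans hs; apply: subseq_cons.
case: (ltngtP x v) => [xv|xv|E]; last by rewrite E eqxx in vx.
  by rewrite /= -IH'.
have e0 : [seq x <- s | x < v] = [::].
  apply/eqP; rewrite -[_ == _]negbK -has_filter; apply/hasPn => y ys.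
  apply/negP => yv; apply: (h x y); last by lia.
  by rewrite eqxx sub1seq.
by rewrite e0 /=; move: IH'; rewrite e0 /= => <-.
Qed.

(** The first letter [v] becomes the root. Avoiding 231 with [v] as the 2 puts all smaller letters
    before all larger ones, and induction turns these two blocks into the subtrees, at offsets [off]
    and [v]. *)
Lemma pre_surj n off pi : perm_eq pi (iota off.+1 n) ->
  (forall a b c, subseq [:: a; b; c] pi -> c < a < b -> False) ->
  exists2 t, tsize t = n & pre t off = pi.
Proof.
have [m] := ubnP n; elim: m n off pi => // m IH n off pi nm hp hav.
have sz : size pi = n by rewrite (perm_size hp) size_iota.
have un : uniq pi by rewrite (perm_uniq hp) iota_uniq.
have mp x : (x \in pi) = (off < x <= off + n) by rewrite (perm_mem hp) mem_iota.
case: pi => [|v s] in hp hav sz un mp *; first by exists BLeaf.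
have hv : off < v <= off + n by rewrite -mp in_cons eqxx.
move: un => /= /andP[vs us].
have ms x : (x \in s) = (off < x <= off + n) && (x != v).
  rewrite -mp in_cons; case: eqP => [->|] /=; first by rewrite (negbTE vs).
  by rewrite andbT.
have es := @split_by_pivot v s _ vs.
have {}es : s = [seq x <- s | x < v] ++ [seq x <- s | v < x].
  by apply: es => b c hs; apply: (hav v b c); rewrite /= eqxx.
have sub s' : subseq s' s -> subseq s' (v :: s).
  by move=> hs; apply: subseq_trans hs _; apply: subseq_cons.
have [l sl el] : exists2 t, tsize t = v - off.+1 & pre t off = [seq x <- s | x < v].
  apply: IH; first by lia.
    apply: uniq_perm; rewrite ?filter_uniq ?iota_uniq // => x.
    by rewrite mem_filter ms mem_iota; lia.
  move=> a b c hs; apply: hav; apply: sub; apply: subseq_trans hs _.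
  exact: filter_subseq.
have [r sr er] : exists2 t, tsize t = off + n - v & pre t v = [seq x <- s | v < x].
  apply: IH; first by lia.
    apply: uniq_perm; rewrite ?filter_uniq ?iota_uniq // => x.
    by rewrite mem_filter ms mem_iota; lia.
  move=> a b c hs; apply: hav; apply: sub; apply: subseq_trans hs _.
  exact: filter_subseq.
exists (BNode l r); rewrite /= sl ?sr; first by lia.
have -> : off + (v - off.+1) + 1 = v by lia.
by rewrite el er -es.
Qed.

(** * The bijection between pattern-avoiding trees and permutations *)

Theorem theorem2 (P : btree) (e : nat -> bool) (n : nat) :
  [/\ (forall T, Tn_avoid n P e T -> Sn_avoid n P e (tau T)),
      (forall T1 T2, Tn_avoid n P e T1 -> Tn_avoid n P e T2 ->
                     tau T1 = tau T2 -> T1 = T2)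
    & (forall pi, Sn_avoid n P e pi -> exists2 T, Tn_avoid n P e T & tau T = pi)].
Proof.
split.
- move=> T [<- hT]; split; [exact: perm_tau|exact: tau_avoids231|].
  by move/tcontains_mcontains.
- by move=> T1 T2 _ _; exact: pre_inj.
- move=> pi [hp h231 hm].
  have [T sT eT] := pre_surj hp (fun a b c => @avoids231_subseq pi a b c h231).
  exists T => //; split=> // /tcontains_mcontains.
  by rewrite /tau eT.
Qed.
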